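(* Let $(X,\tau,\mathfrak{a})$ be an $\mathfrak{a}$-space. If $(X,\tau,\mathfrak{a})$ is $\mathfrak{a}$-locally connected, then every $\mathfrak{a}$-component of $X$ is $\mathfrak{a}$-open (and hence also $\mathfrak{a}$-closed, i.e. both $\mathfrak{a}$-open and $\mathfrak{a}$-closed).
   Context: An aura topological space (or $\mathfrak{a}$-space) $(X,\tau,\mathfrak{a})$ is a topological space $(X,\tau)$ together with a function $\mathfrak{a}:X\to\tau$ (a scope function) such that $x\in\mathfrak{a}(x)$ for every $x\in X$. A subset $A\subseteq X$ is $\mathfrak{a}$-open if $\mathfrak{a}(x)\subseteq A$ for every $x\in A$; the collection $\tau_{\mathfrak{a}}$ of all $\mathfrak{a}$-open sets is a topology on $X$ with $\tau_{\mathfrak{a}}\subseteq\tau$. A subset $F\subseteq X$ is $\mathfrak{a}$-closed if $X\setminus F\in\tau_{\mathfrak{a}}$. The space $(X,\tau,\mathfrak{a})$ is $\mathfrak{a}$-disconnected if there exist nonempty disjoint $U,V\in\tau_{\mathfrak{a}}$ with $X=U\cup V$, and $\mathfrak{a}$-connected otherwise. For a nonempty subset $Y\subseteq X$ with subspace topology $\tau_Y$, the subspace scope function is $\mathfrak{a}_Y(y)=\mathfrak{a}(y)\cap Y$, and $(Y,\tau_Y,\mathfrak{a}_Y)$ is the subspace aura space; its topology $\tau_{\mathfrak{a}_Y}$ consists of the sets $V\subseteq Y$ with $\mathfrak{a}(y)\cap Y\subseteq V$ for all $y\in V$. A subset $Y\subseteq X$ is called $\mathfrak{a}$-connected if $(Y,\tau_Y,\mathfrak{a}_Y)$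 is $\mathfrak{a}_Y$-connected. The $\mathfrak{a}$-component of $x\in X$ is the union of all $\mathfrak{a}$-connected subsets of $X$ containing $x$. The space is $\mathfrak{a}$-locally connected if for every $x\in X$, every $\mathfrak{a}$-open set containing $x$ contains an $\mathfrak{a}$-connected $\mathfrak{a}$-open set containing $x$. *)

(* Defs.v *)
From mathcomp Require Import all_boot all_order all_algebra.
From mathcomp Require Import all_classical.
From mathcomp Require Import topology.

Set Implicit Arguments.
Unset Strict Implicit.
Unset Printing Implicit Defensive.

Local Open Scope classical_set_scope.

Record scope_function (X : topologicalType) := ScopeFunction {
  scope_fun :> X -> set X;
  scope_open : forall x, open (scope_fun x);
  scope_mem : forall x, scope_fun x x
}.

Definition a_open (X : topologicalType) (a : scope_function X) (A : set X) :=
  forall x, A x -> a x `<=` A.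

Definition a_closed (X : topologicalType) (a : scope_function X) (F : set X) :=
  a_open a (~` F).

Definition a_disconnected (X : topologicalType) (a : scope_function X) :=
  exists U V : set X,
    [/\ U !=set0 /\ V !=set0, U `&` V = set0, a_open a U, a_open a V
      & [set: X] = U `|` V].

Definition a_connected (X : topologicalType) (a : scope_function X) :=
  ~ a_disconnected a.

Section subspace_scope.
Variables (X : topologicalType) (a : scope_function X) (Y : set X).

(* The subset Y, seen as a type, carries the library's subspace topology (the
   initial topology of the inclusion [set_val]); the preimage of a(y) under
   the inclusion is a(y) `&` Y seen as a set of points of Y. *)
Definition subspace_scope_fun (y : Y) : set Y := set_val @^-1` a (set_val y).

Lemma subspace_scope_open (y : Y) : open (subspace_scope_fun y).
Proof. by exists (a (set_val y)) => //; exact: scope_open. Qed.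

Lemma subspace_scope_mem (y : Y) : subspace_scope_fun y y.
Proof. exact: scope_mem. Qed.

Definition subspace_scope : scope_function Y :=
  ScopeFunction subspace_scope_open subspace_scope_mem.

End subspace_scope.

(* Subspace aura spaces are only considered on nonempty subsets, so the empty
   set does not count as a connected subset. *)
Definition a_connected_subset (X : topologicalType) (a : scope_function X)
    (Y : set X) :=
  Y !=set0 /\ a_connected (subspace_scope a Y).

Definition a_component (X : topologicalType) (a : scope_function X) (x : X) :
    set X :=
  \bigcup_(Y in [set Y | a_connected_subset a Y /\ Y x]) Y.

Definition a_locally_connected (X : topologicalType) (a : scope_function X) :=
  forall (x : X) (U : set X), a_open a U -> U x ->
    exists V : set X,
      [/\ a_connected_subset a V, a_open a V, V x & V `<=` U].

(* Main.v *)
(** A nonempty subset is a-connected iff every predicate that does not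
    distinguish a point of the subset from the points of its scope is constant
    on the subset. Hence the union of two a-connected sets that meet is
    a-connected, so an a-connected set that meets an a-component lies inside it.
    When the space is a-locally connected, every scope [a x] lies in an
    a-connected set containing [x], so the scope either lies in a given
    component or misses it. *)
Require Import Defs.
From mathcomp Require Import all_boot all_order all_algebra.
From mathcomp Require Import all_classical.
From mathcomp Require Import topology.

Local Open Scope classical_set_scope.

(** A non-constant [P] and its complement trace a separation on [Y]; conversely, one half of a
    separation gives such a [P]. Predicates on [X] keep later arguments out of the subtype of
    [Y]. *)
Lemma a_connected_subsetP (X : topologicalType) (a : scope_function X)
    (Y : set X) :
  a_connected_subset a Y <->
  Y !=set0 /\ forall P : set X,
    (forall y z, Y y -> Y z -> a y z -> (P y <-> P z)) ->
    forall y z, Y y -> Y z -> P y -> P z.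
Proof.
split=> -[Y0 conY]; split=> //.
  move=> P Pa y z Yy Yz Py; apply: contrapT => nPz; apply: conY.
  exists (set_val @^-1` P), (set_val @^-1` (~` P)); split.
  - by split; [exists (SigSub (mem_set Yy)) | exists (SigSub (mem_set Yz))].
  - by rewrite -preimage_setI setICr preimage_set0.
  - move=> u Pu v auv.
    by apply: (proj1 (Pa _ _ (set_valP u) (set_valP v) auv)).
  - move=> u nPu v auv Pv; apply: nPu.
    by apply: (proj2 (Pa _ _ (set_valP u) (set_valP v) auv)).
  - by rewrite -preimage_setU setUv preimage_setT.
move=> -[U [V [[[u Uu] [v Vv]] UV0 oU oV UVT]]].
have disj (w : Y) : U w -> V w -> False.
  by move=> Uw Vw; have : (U `&` V) w by []; rewrite UV0.
have cover (w : Y) : U w \/ V w by have : [set: Y] w by []; rewrite UVT.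
pose P : set X := set_val @` U.
have PU (w : Y) : P (set_val w) -> U w by move=> [w' Uw' /val_inj <-].
suff : P (set_val v) by move=> /PU /disj; exact.
apply: (conY P _ _ _ (set_valP u) (set_valP v)); last by exists u.
move=> y z Yy Yz ayz.
pose y' : Y := SigSub (mem_set Yy); pose z' : Y := SigSub (mem_set Yz).
split=> [Py|Pz]; first by exists z' => //; apply: (oU y') => //; exact: PU.
(* If [y'] were in [V], a-openness of [V] would put [z'] in both [U] and [V]. *)
exists y' => //; case: (cover y') => // Vy.
by case: (disj z'); [exact: PU | exact: (oV y')].
Qed.

Lemma a_connected_subsetU (X : topologicalType) (a : scope_function X)
    (Y Z : set X) :
  Y `&` Z !=set0 -> a_connected_subset a Y -> a_connected_subset a Z ->
  a_connected_subset a (Y `|` Z).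
Proof.
move=> [p [Yp Zp]] /a_connected_subsetP[_ conY] /a_connected_subsetP[_ conZ].
apply/a_connected_subsetP; split; first by exists p; left.
move=> P Pa.
have {}conY := conY P (fun y z Yy Yz => Pa y z (or_introl Yy) (or_introl Yz)).
have {}conZ := conZ P (fun y z Zy Zz => Pa y z (or_intror Zy) (or_intror Zz)).
move=> y z YZy YZz Py.
have Pp : P p by case: YZy => h; [exact: (conY y) | exact: (conZ y)].
by case: YZz => h; [exact: (conY p) | exact: (conZ p)].
Qed.

(** A connected [Y] joins [x] to the common point [p], so the union of [Y] and [V] is one of the
    sets forming the component. *)
Lemma a_component_maximal (X : topologicalType) (a : scope_function X) (x : X)
    (V : set X) :
  a_connected_subset a V -> a_component a x `&` V !=set0 ->
  V `<=` a_component a x.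
Proof.
move=> conV [p [[Y [conY Yx] Yp] Vp]] z Vz.
exists (Y `|` V); last by right.
by split; [apply: a_connected_subsetU => //; exists p | left].
Qed.

Theorem theorem4p19 (X : topologicalType) (a : scope_function X) :
  a_locally_connected a ->
  forall x : X, a_open a (a_component a x) /\ a_closed a (a_component a x).
Proof.
move=> lcX x.
have scope_sub y : exists V, [/\ a_connected_subset a V, V y & a y `<=` V].
  have [//|//|V [conV oV Vy _]] := lcX y setT.
  by exists V; split=> //; exact: oV.
split=> y Cy z ayz; have [V [conV Vy aV]] := scope_sub y.
  apply: (a_component_maximal _ _ _ _ conV) (aV _ ayz).
  by exists y.
(* If [z] were in the component, [V] would meet it and bring [y] in. *)
move=> Cz; apply: Cy; apply: (a_component_maximal _ _ _ _ conV) Vy.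
by exists z; split=> //; exact: aV.
Qed.
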